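(* Let $C_m=\frac{1}{m+1}\binom{2m}{m}$ denote the $m$-th Catalan number. Label the vertices of a regular convex $N$-gon by $0,1,\ldots,N-1$ in cyclic order, and for vertices $x\neq y$ and an integer $k\ge 0$ let $f_{xy}(N,k)$ denote the number of triangulations of this $N$-gon containing exactly $k$ diagonals parallel to the segment $xy$. In the sums below, $(i_1,\ldots,i_{k+1})$ ranges over all tuples of positive integers with the indicated sum. (i) If $n\ge 2$ and $k\ge 1$, then \[f_{01}(2n,k)=\sum_{i_1+\cdots+i_{k+1}=n-1} 2^{k+1}C_{2i_1-1}C_{2i_2-1}\cdots C_{2i_{k+1}-1}.\] (ii) If $n\ge 2$ and $k\ge 1$, then \[f_{02}(2n,k)=\sum_{i_1+\cdots+i_{k+1}=n} 2^{k-1}\bigl(2^{2i_1-1}C_{i_1-1}-C_{2i_1-1}\bigr)\bigl(2^{2i_2-1}C_{i_2-1}-C_{2i_2-1}\bigr)C_{2i_3-1}C_{2i_4-1}\cdots C_{2i_{k+1}-1}.\] (iii) If $n\ge 1$ and $k\ge 1$, then \[f_{01}(2n+1,k)=\sum_{i_1+\cdots+i_{k+1}=n} 2^{k}\bigl(2^{2i_1-1}C_{i_1-1}-C_{2i_1-1}\bigr)C_{2i_2-1}C_{2i_3-1}\cdots C_{2i_{k+1}-1}.\]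
   Context: A triangulation of a convex $N$-gon is a maximal set of pairwise non-crossing diagonals (there are $N-3$ of them), viewed as a graph on the vertices $0,\ldots,N-1$ whose edges are the sides $01,12,\ldots,(N-1)0$ together with these diagonals. Here $xy$ may be a side (e.g. $01$) or a diagonal (e.g. $02$) of the regular polygon, and ''parallel'' means parallel as line segments in the regular $N$-gon (equivalently, $ab$ is parallel to $cd$ iff $a+b\equiv c+d\pmod N$). Empty products (e.g. $C_{2i_3-1}\cdots C_{2i_{k+1}-1}$ when $k=1$) equal $1$. *)

(* Defs.v *)
From mathcomp Require Import all_boot all_order all_algebra.
Set Implicit Arguments. Unset Strict Implicit. Unset Printing Implicit Defensive.

(* Catalan number C_m = binom(2m,m)/(m+1) (the division is exact). *)
Definition catalan (m : nat) : nat := 'C(2 * m, m) %/ m.+1.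

(* Vertices of the convex N-gon are 'I_N; a diagonal is stored as an ordered
   pair (a, b) with a < b, the vertices non-adjacent in the cyclic order. *)
Definition diagonal (N : nat) (d : 'I_N * 'I_N) : bool :=
  [&& (d.1 : nat).+1 < d.2 & ~~ (((d.1 : nat) == 0) && ((d.2 : nat) == N.-1))].

Definition crossing (N : nat) (d e : 'I_N * 'I_N) : bool :=
  ((d.1 < e.1 < d.2) && (d.2 < e.2)) || ((e.1 < d.1 < e.2) && (e.2 < d.2)).

Definition noncrossing (N : nat) (T : {set 'I_N * 'I_N}) : bool :=
  [forall d in T, forall e in T, ~~ crossing d e].

Definition triangulation (N : nat) (T : {set 'I_N * 'I_N}) : bool :=
  [&& [forall d in T, diagonal d], noncrossing T &
      [forall d, (diagonal d && (d \notin T)) ==> ~~ noncrossing (d |: T)]].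

(* ab is parallel to cd iff a + b = c + d (mod N) *)
Definition num_parallel (N : nat) (x y : nat) (T : {set 'I_N * 'I_N}) : nat :=
  #|[set d in T | ((d.1 : nat) + d.2) %% N == (x + y) %% N]|.

Definition f (N : nat) (x y k : nat) : nat :=
  #|[set T : {set 'I_N * 'I_N} | triangulation T && (num_parallel x y T == k)]|.

Definition composition (n : nat) (r m : nat) (c : {ffun 'I_r -> 'I_m}) : bool :=
  [forall j, 0 < (c j : nat)] && (\sum_(j < r) (c j : nat) == n).

(* Main.v *)
(* After rotating the polygon by one step, the class of chords parallel to xy
   becomes {(r, s - r)} with s = N - 1 or s = N, a nested chain.  Cutting along
   the members of the class that occur in a triangulation leaves pieces whose
   triangulations avoid the class, so the generating function of f is a product
   of the generating functions of the pieces.  The latter are determined by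
   summing over all k: every piece has a Catalan number of triangulations, and
   cutting at the first (or last) class chord gives a recurrence.  For a piece
   between two chords it is the Segner recurrence split by parity, giving
   2 C_(2i-1); for a piece at an end of the chain that degenerates to a vertex
   it also needs sum_i C_(2i) C_(2(m-i)) = 4^m C_m. *)
Require Import Defs.
From mathcomp Require Import all_boot all_order all_algebra.
From mathcomp Require Import zify ring.
Import GRing.Theory Num.Theory.
Local Open Scope ring_scope.

Set Implicit Arguments.
Unset Strict Implicit.
Unset Printing Implicit Defensive.

(** * Catalan numbers *)

(** From [(m+1) * 'C(2m, m+1) = m * 'C(2m, m)] and coprimality of [m] and [m+1], the division in
    [catalan] is exact. *)
Lemma mul_catalan (m : nat) : (m.+1 * catalan m = 'C(2 * m, m))%N.
Proof.
rewrite /catalan mulnC divnK //.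
have e := mul_bin_left (2 * m) m.
have {e} e : (m.+1 * 'C(2 * m, m.+1) = m * 'C(2 * m, m))%N by rewrite e;
  congr (_ * _)%N; lia.
rewrite -(@Gauss_dvdr _ m) ?coprimeSn // -e; exact: dvdn_mulr.
Qed.

Lemma catalan0 : catalan 0 = 1%N.
Proof. by []. Qed.

Lemma catalan_rec (m : nat) :
  (m.+2 * catalan m.+1 = (4 * m + 2) * catalan m)%N.
Proof.
have e1 := mul_catalan m; have e2 := mul_catalan m.+1.
have e3 := mul_bin_diag (2 * m).+2 m; have e4 := mul_bin_down (2 * m).+1 m.
rewrite (_ : (2 * m.+1 = (2 * m).+2)%N) in e2; last by lia.
rewrite /= -?e1 -?e2 in e3 e4.
rewrite (_ : ((2 * m).+1 - m = m.+1)%N) in e4; last by lia.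
have e5 : ((2 * m).+1 * catalan m = 'C((2 * m).+1, m))%N.
  by apply/eqP; rewrite -(@eqn_pmul2l m.+1) // -e4; apply/eqP; lia.
by apply/eqP; rewrite -(@eqn_pmul2l m.+1) // -e3 -e5; apply/eqP; lia.
Qed.

Lemma catalan_segner (n : nat) :
  catalan n.+1 = (\sum_(i < n.+1) catalan i * catalan (n - i))%N.
Proof.
(* Symmetrizing i <-> m - i turns a linear weight into its mean value. *)
have wsum (m : nat) (a b : nat) :
    (2 * \sum_(i < m.+1) (a * i + b) * (catalan i * catalan (m - i)) =
     (a * m + 2 * b) * \sum_(i < m.+1) catalan i * catalan (m - i))%N.
  rewrite mul2n -addnn {1}(reindex_inj rev_ord_inj) /= -big_split big_distrr /=.
  apply: eq_bigr => i _; have := ltn_ord i => lt_i.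
  have e : (m - (m.+1 - i.+1) = i)%N by lia.
  have e' : (m.+1 - i.+1 = m - i)%N by lia.
  rewrite e e'; set x := catalan i; set y := catalan _.
  have -> : (a * m = a * i + a * (m - i))%N by rewrite -mulnDr; congr muln; lia.
  ring.
elim: n => [|n IHn]; first by rewrite big_ord1.
(* With weight [i + 1], the term [i = 0] is [C_(n+1)], and [catalan_rec] turns the others into the
   sum for [n] with weight [4i + 2]; [wsum] evaluates both weighted sums. *)
have e := wsum n.+1 1%N 1%N.
rewrite big_ord_recl /= mulnDr in e.
have e' : (\sum_(i < n.+1) (1 * bump 0 i + 1) *
            (catalan (bump 0 i) * catalan (n.+1 - bump 0 i)) =
    \sum_(i < n.+1) (4 * i + 2) * (catalan i * catalan (n - i)))%N.
  apply: eq_bigr => i _; rewrite /bump /= add1n subSS !mulnA; congr muln.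
  by rewrite -catalan_rec; congr muln; lia.
rewrite e' wsum -IHn in e.
have e2 := catalan_rec n.+1.
rewrite catalan0 subn0 in e.
move: (\sum_(i < _) _)%N (catalan n.+1) e e2 => S c e e2.
by apply/eqP; rewrite -(@eqn_pmul2l n.+3) // e2; apply/eqP; nia.
Qed.

Lemma sum_parity (a : nat -> nat) (m : nat) :
  (\sum_(i < 2 * m) a i =
   \sum_(i < m) a (2 * i) + \sum_(i < m) a (2 * i).+1)%N.
Proof.
elim: m => [|m IHm]; first by rewrite muln0 !big_ord0.
rewrite (_ : 2 * m.+1 = (2 * m).+2)%N; last by lia.
by rewrite !big_ord_recr /= IHm addnACA addnA.
Qed.

(** The indices in the Segner sum add up to the odd number [2d + 1], so each product has one even
    and one odd index and occurs twice. *)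
Lemma catalan_double (d : nat) :
  catalan (2 * d.+1) =
  (\sum_(i < d.+1) 2 * catalan (2 * i).+1 * catalan (2 * (d - i)))%N.
Proof.
rewrite (_ : 2 * d.+1 = (2 * d).+2)%N; last by lia.
rewrite catalan_segner.
rewrite (_ : (2 * d).+2 = 2 * d.+1)%N; last by lia.
rewrite (sum_parity (fun i => catalan i * catalan ((2 * d).+1 - i))%N).
rewrite (reindex_inj rev_ord_inj) /= -big_split; apply: eq_bigr => i _ /=.
have lt_i := ltn_ord i.
have -> : ((2 * d).+1 - 2 * (d.+1 - i.+1) = (2 * i).+1)%N by lia.
have -> : ((2 * d).+1 - (2 * i).+1 = 2 * (d - i))%N by lia.
rewrite subSS; ring.
Qed.

(** Here the indices add up to [2m], hence have equal parity: even pairs first, then odd ones. *)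
Lemma catalan_doubleS (m : nat) :
  catalan (2 * m).+1 =
  (\sum_(i < m.+1) catalan (2 * i) * catalan (2 * (m - i)) +
   \sum_(i < m) catalan (2 * i).+1 * catalan (2 * (m - i)).-1)%N.
Proof.
rewrite catalan_segner big_ord_recr /=.
rewrite (sum_parity (fun i => catalan i * catalan (2 * m - i))%N) big_ord_recr /=.
rewrite addnAC; congr (_ + _ + _)%N.
- by apply: eq_bigr => i _; congr (_ * catalan _)%N; lia.
- by congr (_ * catalan _)%N; lia.
by apply: eq_bigr => i _; congr (_ * catalan _)%N; lia.
Qed.

(** * Truncated power series and the even Catalan convolution *)

Lemma coef_trunc_mul (R : comNzRingType) (N d : nat) (a b : nat -> R) : (d < N)%N ->
  ((\poly_(i < N) a i) * (\poly_(i < N) b i))`_d = \sum_(i < d.+1) a i * b (d - i)%N.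
Proof.
move=> lt_dN; rewrite coefM; apply: eq_bigr => i _.
by rewrite !coef_poly; congr (_ * _); case: ifP => //; have := ltn_ord i; lia.
Qed.

(** Agreement below degree [N] becomes an equation with an explicit remainder, so that later
    eliminations are plain ring identities. *)
Lemma eq_mod_Xn (R : comNzRingType) (N : nat) (p q : {poly R}) :
  (forall d, (d < N)%N -> p`_d = q`_d) -> exists r, p = q + r * 'X^N.
Proof.
move=> e; exists (drop_poly N (p - q)).
suff e0 : take_poly N (p - q) = 0.
  by have := poly_take_drop N (p - q); rewrite e0 add0r => ->; rewrite addrC subrK.
apply/polyP => d; rewrite coef_take_poly coef0.
by case: ifP => // /e; rewrite coefB => ->; rewrite subrr.
Qed.

Lemma Posz_sum (I : Type) (r : seq I) (P : pred I) (F : I -> nat) :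
  (\sum_(i <- r | P i) F i)%N%:Z = \sum_(i <- r | P i) (F i)%:Z.
Proof. exact: (big_morph Posz PoszD erefl). Qed.

(** Let [E] and [O] generate the Catalan numbers of even and odd index. The parity recurrences read
    [E = 1 + 2XOE] and [O = E^2 + XO^2]; eliminating [O] gives [F = 1 + 4XF^2] for [F = E^2], the
    equation of the Catalan series at [4X]. *)
Lemma catalan_even_convolution (m : nat) :
  (\sum_(i < m.+1) catalan (2 * i) * catalan (2 * (m - i)) = 4 ^ m * catalan m)%N.
Proof.
pose N := m.+1.
pose ev i : int := (catalan (2 * i))%:Z; pose od i : int := (catalan (2 * i).+1)%:Z.
pose E := \poly_(i < N) ev i; pose O := \poly_(i < N) od i.
have [r1 e1] : exists r, E = 1 + 2 * 'X * (O * E) + r * 'X^N.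
  apply: eq_mod_Xn => -[|d] lt_d;
    rewrite coefD coef_poly lt_d coef1 -mulrA mulr_natl coefMn coefXM ?mul0rn //=.
  rewrite add0r coef_trunc_mul; last by lia.
  rewrite /ev catalan_double -mulr_natl mulr_sumr Posz_sum.
  by apply: eq_bigr => i _; rewrite !PoszM -mulrA.
have [r2 e2] : exists r, O = E * E + 'X * (O * O) + r * 'X^N.
  apply: eq_mod_Xn => d lt_d; rewrite coefD coef_poly lt_d coefXM coef_trunc_mul //.
  rewrite /od catalan_doubleS PoszD; congr (_ + _).
    rewrite Posz_sum; apply: eq_bigr => i _; by rewrite PoszM.
  case: d lt_d => [|d] lt_d; first by rewrite big_ord0.
  rewrite /= coef_trunc_mul; last by lia.
  rewrite Posz_sum; apply: eq_bigr => i _; rewrite PoszM /od.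
  by congr (_ * (catalan _)%:Z); have := ltn_ord i; lia.
have [r e] : exists r, E * E = 1 + 4%:R *: ('X * ((E * E) * (E * E))) + r * 'X^N.
  (* Modulo 'X^N the relations read E (1 - 2XO) = 1 and XO^2 = O - E^2. *)
  have u1 : 1 + r1 * 'X^N = E * (1 - 2 * 'X * O).
    have -> : E * (1 - 2 * 'X * O) = E - 2 * 'X * (O * E) by ring.
    by rewrite {1}e1; ring.
  have u2 : r2 * 'X^N = O - E * E - 'X * (O * O) by rewrite {1}e2; ring.
  (* Squaring the first relation yields the terms in [r1]; the second, multiplied by [4XE^2], yields
     the term in [r2]. *)
  exists (2 * r1 + r1 * r1 * 'X^N + 4 * 'X * E * E * r2).
  rewrite -mul_polyC.
  have -> : (2 * r1 + r1 * r1 * 'X^N + 4 * 'X * E * E * r2) * 'X^N =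
     (1 + r1 * 'X^N) ^+ 2 - 1 + 4 * 'X * E * E * (r2 * 'X^N) by ring.
  by rewrite u1 u2 polyC_natr; ring.
have F d : (d < N)%N -> (E * E)`_d = (4 ^ d * catalan d)%:Z.
  elim/ltn_ind: d => -[|d] IH lt_d.
    by rewrite /E coef_trunc_mul // big_ord1.
  rewrite e !coefD coef1 coefZ coefXM coefMXn lt_d addr0 add0r /= coefM.
  rewrite catalan_segner expnS -mulnA PoszM; congr (_ * _).
  rewrite big_distrr /= Posz_sum; apply: eq_bigr => i _.
  have lt_i := ltn_ord i; rewrite !IH; try lia.
  rewrite -PoszM; congr Posz.
  rewrite (_ : (4 ^ d = 4 ^ i * 4 ^ (d - i))%N); first by ring.
  by rewrite -expnD; congr expn; lia.
have := F m (ltnSn m); rewrite /E coef_trunc_mul // => /esym e'.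
apply/eqP; rewrite -eqz_nat e' Posz_sum; apply/eqP.
by apply: eq_bigr => i _; rewrite PoszM.
Qed.

(** * Maximal non-crossing sets *)

Section MaximalNoncrossing.
Variable N : nat.
Implicit Types (d e : 'I_N * 'I_N) (P T : {set 'I_N * 'I_N}).

(* Non-crossing and maximality in one equation: T consists of exactly the
   members of P crossing no member of T. *)
Definition max_noncrossing P T : bool :=
  T == [set d in P | [forall e in T, ~~ crossing d e]].

Lemma crossing_sym d e : crossing d e = crossing e d.
Proof. by rewrite /crossing orbC. Qed.

Lemma crossing_irr d : crossing d d = false.
Proof. by rewrite /crossing ltnn. Qed.

Lemma max_noncrossingP P T :
  reflect (forall d, (d \in T) = (d \in P) && [forall e in T, ~~ crossing d e])
          (max_noncrossing P T).
Proof.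
apply: (iffP eqP) => [e d | e]; last by apply/setP => d; rewrite inE.
by rewrite {1}e inE.
Qed.

Lemma max_noncrossing_sub P T : max_noncrossing P T -> T \subset P.
Proof. by move=> /max_noncrossingP e; apply/subsetP => d; rewrite e => /andP[]. Qed.

Lemma max_noncrossing_nc P T : max_noncrossing P T ->
  {in T &, forall d e, ~~ crossing d e}.
Proof.
by move=> /max_noncrossingP E d e dT eT; move: dT; rewrite E => /andP[_ /forall_inP];
  apply.
Qed.

Lemma max_noncrossing_max P T d : max_noncrossing P T -> d \in P ->
  {in T, forall e, ~~ crossing d e} -> d \in T.
Proof. by move=> /max_noncrossingP E dP dT; rewrite E dP; apply/forall_inP. Qed.

Lemma max_noncrossing_trivial P T : {in P &, forall d e, ~~ crossing d e} ->
  max_noncrossing P T = (T == P).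
Proof.
move=> nc; apply/idP/eqP => [mT | ->].
  have sT := max_noncrossing_sub mT; apply/eqP; rewrite eqEsubset sT.
  apply/subsetP => d dP; apply: (max_noncrossing_max mT dP) => e /(subsetP sT).
  exact: nc.
apply/max_noncrossingP => d; case dP: (d \in P) => //=.
by apply/esym/forall_inP => e; apply: nc.
Qed.

(** [P1] and [P2] may overlap: a chord in both crosses nothing in either, so it lies in every
    maximal set and the two parts agree on it. *)
Lemma max_noncrossingU P1 P2 T1 T2 :
  (forall d e, d \in P1 -> e \in P2 -> ~~ crossing d e) ->
  max_noncrossing P1 T1 -> max_noncrossing P2 T2 ->
  [/\ max_noncrossing (P1 :|: P2) (T1 :|: T2),
      (T1 :|: T2) :&: P1 = T1 & (T1 :|: T2) :&: P2 = T2].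
Proof.
move=> nc m1 m2.
have s1 := subsetP (max_noncrossing_sub m1).
have s2 := subsetP (max_noncrossing_sub m2).
pose K d := [forall e in T1 :|: T2, ~~ crossing d e].
have k1 d : (d \in T1) = (d \in P1) && K d.
  move/max_noncrossingP: (m1) => ->; case dP: (d \in P1) => //=.
  apply/forall_inP/forall_inP => H e; last by move=> eT; apply: H; rewrite inE eT.
  by rewrite inE => /orP[/H //|/s2 /(nc _ _ dP)].
have k2 d : (d \in T2) = (d \in P2) && K d.
  move/max_noncrossingP: (m2) => ->; case dP: (d \in P2) => //=.
  apply/forall_inP/forall_inP => H e; last by move=> eT; apply: H; rewrite inE eT orbT.
  by rewrite inE => /orP[/s1 eP|/H //]; rewrite crossing_sym nc.
split; [apply/max_noncrossingP => d; rewrite -/(K d) | apply/setP => d | apply/setP => d];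
  by rewrite !inE k1 k2; case: (d \in P1); case: (d \in P2); case: (K d).
Qed.

Lemma max_noncrossing_restrict P1 P2 T :
  (forall d e, d \in P1 -> e \in P2 -> ~~ crossing d e) ->
  max_noncrossing (P1 :|: P2) T ->
  max_noncrossing P1 (T :&: P1) /\ max_noncrossing P2 (T :&: P2).
Proof.
move=> nc mT.
have sT := subsetP (max_noncrossing_sub mT); move/max_noncrossingP: (mT) => E.
split; apply/max_noncrossingP => d; rewrite !inE E !inE andbC.
  case dP : (d \in P1) => //=; apply/forall_inP/forall_inP => H e.
    by rewrite inE => /andP[/H].
  by move=> eT; have := sT e eT; rewrite inE => /orP[eP|/(nc _ _ dP)//]; apply: H;
    rewrite inE eT.
case dP : (d \in P2) => //=; rewrite orbT; apply/forall_inP/forall_inP => H e.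
  by rewrite inE => /andP[/H].
move=> eT; have := sT e eT; rewrite inE => /orP[/nc /(_ dP)|eP];
  first by rewrite crossing_sym.
by apply: H; rewrite inE eT.
Qed.

(** Once [d] is in [T], candidates crossing [d] are excluded anyway. *)
Lemma max_noncrossing_fix P T d : d \in P -> d \in T ->
  max_noncrossing P T = max_noncrossing [set e in P | ~~ crossing d e] T.
Proof.
move=> dP dT.
suff H e : (e \in P) && [forall x in T, ~~ crossing e x] =
    (e \in [set e in P | ~~ crossing d e]) && [forall x in T, ~~ crossing e x].
  by apply/max_noncrossingP/max_noncrossingP => E e; rewrite E H.
rewrite inE -andbA; congr (_ && _); rewrite andb_idl // => /forall_inP/(_ d dT).
by rewrite crossing_sym.
Qed.

Lemma card_max_noncrossingU P1 P2 (Q1 Q2 : pred {set 'I_N * 'I_N}) :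
  (forall d e, d \in P1 -> e \in P2 -> ~~ crossing d e) ->
  #|[set T | [&& max_noncrossing (P1 :|: P2) T, Q1 (T :&: P1) & Q2 (T :&: P2)]]| =
  (#|[set T | max_noncrossing P1 T && Q1 T]| *
   #|[set T | max_noncrossing P2 T && Q2 T]|)%N.
Proof.
move=> nc; rewrite -cardsX.
set A := [set T | _]; pose F T := (T :&: P1, T :&: P2).
have injF : {in A &, injective F}.
  have FK : {in A, forall T, (F T).1 :|: (F T).2 = T}.
    move=> T; rewrite inE => /andP[/max_noncrossing_sub/setIidPl e _].
    by rewrite /= -setIUr e.
  by move=> T T' /FK {2}<- /FK {2}<- ->.
rewrite -(card_in_imset injF); apply: eq_card => -[T1 T2]; rewrite !inE /=.
apply/imsetP/andP => [[T] | [/andP[m1 q1] /andP[m2 q2]]].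
  rewrite inE => /and3P[mT q1 q2] [-> ->].
  by have [-> ->] := max_noncrossing_restrict nc mT.
have [mT e1 e2] := max_noncrossingU nc m1 m2.
by exists (T1 :|: T2); rewrite ?inE /F e1 e2 // mT q1.
Qed.

Lemma card_max_noncrossing_cut P P1 P2 d (Q1 Q2 : pred {set 'I_N * 'I_N}) :
  d \in P -> [set e in P | ~~ crossing d e] = P1 :|: P2 ->
  d \in P1 ->
  (forall d e, d \in P1 -> e \in P2 -> ~~ crossing d e) ->
  #|[set T | [&& max_noncrossing P T, d \in T, Q1 (T :&: P1) & Q2 (T :&: P2)]]| =
  (#|[set T | max_noncrossing P1 T && Q1 T]| *
   #|[set T | max_noncrossing P2 T && Q2 T]|)%N.
Proof.
move=> dP eP dP1 nc; rewrite -card_max_noncrossingU //; apply: eq_card => T; rewrite !inE.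
(* If [d] is missing, both conditions fail: a maximal subset of [P1 :|: P2] contains [d], which
   crosses none of these chords. *)
case: (boolP (d \in T)) => dT; first by rewrite (max_noncrossing_fix dP dT) eP.
rewrite andbF; apply/esym/negbTE; rewrite negb_and; apply/orP; left; apply: contra dT.
rewrite -eP => mT; apply: (max_noncrossing_max mT); first by rewrite inE dP crossing_irr.
by move=> e /(subsetP (max_noncrossing_sub mT)); rewrite inE => /andP[].
Qed.

End MaximalNoncrossing.

(** * Triangulations with their sides *)

Section Chords.
Variable N : nat.
Implicit Types (d e : 'I_N * 'I_N) (V : {set 'I_N}) (T : {set 'I_N * 'I_N}).

(* Pairs of consecutive vertices of V, i.e. sides of the polygon, are included;
   they belong to every maximal non-crossing set. *)
Definition chords V : {set 'I_N * 'I_N} :=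
  [set d | [&& d.1 \in V, d.2 \in V & (d.1 < d.2)%N]].

Definition inside V (d : 'I_N * 'I_N) : {set 'I_N} := [set x in V | (d.1 <= x <= d.2)%N].

Definition outside V (d : 'I_N * 'I_N) : {set 'I_N} := [set x in V | (x <= d.1)%N ||
    (d.2 <= x)%N].

Lemma chords_not_crossing V d : d \in chords V ->
  [set e in chords V | ~~ crossing d e] = chords (inside V d) :|: chords (outside V d).
Proof.
case: d => a b; rewrite inE /= => /and3P[aV bV lt_ab]; apply/setP => -[x y].
rewrite !inE /crossing /=; case: (x \in V); case: (y \in V) => //=; lia.
Qed.

Lemma inside_outside_not_crossing V d e e' :
  e \in chords (inside V d) -> e' \in chords (outside V d) -> ~~ crossing e e'.
Proof.
case: d e e' => a b [x y] [z t]; rewrite !inE /crossing /=.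
case: (x \in V); case: (y \in V); rewrite ?andbF //=.
case: (z \in V); case: (t \in V); rewrite ?andbF //=; lia.
Qed.

Lemma mem_chords_inside V d : d \in chords V -> d \in chords (inside V d).
Proof. by case: d => a b; rewrite !inE /= => /and3P[-> -> lt]; lia. Qed.

Lemma card_chords_cut V d (Q1 Q2 : pred {set 'I_N * 'I_N}) : d \in chords V ->
  #|[set T | [&& max_noncrossing (chords V) T, d \in T,
       Q1 (T :&: chords (inside V d)) & Q2 (T :&: chords (outside V d))]]| =
  (#|[set T | max_noncrossing (chords (inside V d)) T && Q1 T]| *
   #|[set T | max_noncrossing (chords (outside V d)) T && Q2 T]|)%N.
Proof.
move=> dV; apply: card_max_noncrossing_cut => //.
- exact: chords_not_crossing.
- exact: mem_chords_inside.
- exact: inside_outside_not_crossing.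
Qed.

(** Two crossing chords have four distinct endpoints, so here all chords are compatible and
    [chords V] is the only maximal set. *)
Lemma card_max_noncrossing_trivial V (Q : pred {set 'I_N * 'I_N}) :
  (#|V| <= 3)%N ->
  #|[set T | max_noncrossing (chords V) T && Q T]| = Q (chords V).
Proof.
move=> leV.
have nc : {in chords V &, forall d e, ~~ crossing d e}.
  move=> [a b] [c e]; rewrite !inE /= => /and3P[aV bV lt_ab] /and3P[cV eV lt_ce].
  apply/negP => cr; suff : (3 < #|V|)%N by lia.
  have u : uniq [:: a; b; c; e].
    by rewrite /= !inE -!val_eqE /=; move: cr; rewrite /crossing /=; lia.
  rewrite -[(3 < _)%N]/(size [:: a; b; c; e] <= _)%N -(card_uniqP u).
  by apply/subset_leq_card/subsetP => x; rewrite !inE => /or4P[] /eqP ->.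
have [q|q] := boolP (Q _); last first.
  apply: eq_card0 => T; rewrite inE max_noncrossing_trivial //.
  by apply/negP => /andP[/eqP ->]; apply/negP.
apply/eqP/cards1P; exists (chords V); apply/setP => T;
  rewrite !inE max_noncrossing_trivial //.
by case: eqP => // ->.
Qed.

(** Ranks in [A] take each value below [#|A|] once; the induction removes the largest element. This
    turns a sum over apices into Segner's sum. *)
Lemma sum_rank (A : {set 'I_N}) (phi : nat -> nat) :
  (\sum_(c in A) phi #|[set x in A | (x < c)%N]| = \sum_(i < #|A|) phi i)%N.
Proof.
elim: {A}_.+1 {-2}A (ltnSn #|A|) => // m IH A leA.
have [-> | [x0 x0A]] := set_0Vmem A; first by rewrite cards0 big_ord0 big_set0.
case: (arg_maxnP (fun i : 'I_N => i : nat) x0A) => c cA' maxc.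
have {cA'} cA : c \in A by [].
rewrite (cardsD1 c A) cA add1n in leA *; rewrite big_ord_recr /= -IH //.
rewrite (bigD1 c) //= addnC; congr (_ + _)%N.
  rewrite [LHS](eq_bigl (mem (A :\ c))); last by move=> i; rewrite !inE andbC.
  apply: eq_bigr => i; rewrite !inE => /andP[ne_ic iA]; congr phi; apply: eq_card => x.
  rewrite !inE; case: eqP => // ->; rewrite cA /=; have := maxc i iA; lia.
congr phi; apply: eq_card => x; rewrite !inE -val_eqE /=.
by case: (boolP (x \in A)) => [xA | _]; rewrite ?andbF //=; have := maxc x xA; lia.
Qed.

(** [c] is the apex of the triangle of [T] on the side [(a, b)]: the largest vertex below [b] that
    is joined to [a]. *)
Lemma max_noncrossing_apex V T a b : max_noncrossing (chords V) T ->
   a \in V -> b \in V -> {in V, forall x : 'I_N, (a <= x <= b)%N} -> (2 < #|V|)%N ->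
   exists! c : 'I_N, [/\ c \in V, (a < c < b)%N, (a, c) \in T & (c, b) \in T].
Proof.
move=> mT aV bV ab V2.
have inT := max_noncrossing_max mT; have nc := max_noncrossing_nc mT.
have sT := subsetP (max_noncrossing_sub mT).
have [x0 x0V x0ab] : exists2 x, x \in V & (a < x < b)%N.
  have : (0 < #|V :\: [set a; b]|)%N.
    rewrite cardsD; have := subset_leq_card (subsetIr V [set a; b]); rewrite cards2; lia.
  rewrite card_gt0 => /set0Pn[x]; rewrite !inE -!val_eqE /= => /andP[ne xV].
  by exists x => //; have := ab x xV; lia.
pose R (c : 'I_N) := [&& c \in V, (a < c < b)%N & (a, c) \in T].
(* The vertex of [V] following [a] qualifies: its segment from [a] is a side and crosses nothing. *)
have [c0 c0P] : exists c, [&& c \in V, (a < c < b)%N & (a, c) \in T].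
  have x0P : [pred x : 'I_N | (x \in V) && (a < x)%N] x0 by rewrite /= x0V; lia.
  case: (arg_minnP (fun i : 'I_N => i : nat) x0P) => c /andP[cV lt_ac] minc'; exists c.
  have {}minc (x : 'I_N) : x \in V -> (a < x)%N -> (c <= x)%N.
    by move=> xV ax; apply: minc'; rewrite /= xV.
  have lt_cb : (c < b)%N by have := minc x0 x0V; lia.
  rewrite /R cV lt_ac lt_cb /=; apply: inT => [|[e1 e2] /sT].
    by rewrite inE aV cV.
  rewrite inE /= => /and3P[/[dup] /ab h1 e1V /[dup] /ab h2 e2V lt]; apply/negP;
    rewrite /crossing /=.
  have := minc e1 e1V; have := minc e2 e2V; lia.
case: (@arg_maxnP _ c0 R (fun i : 'I_N => i : nat) c0P) => c /and3P[cV acb acT] maxc'.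
have {maxc'} maxc (x : 'I_N) : x \in V -> (a < x < b)%N -> (a, x) \in T -> (x <= c)%N.
  by move=> xV ax xT; apply: maxc'; rewrite /R xV ax.
exists c; split.
  (* A chord of [T] crossing [(c, b)] would either cross [(a, c)] or join [a] to a vertex beyond
     [c], against the choice of [c]. *)
  split=> //; apply: inT => [|[e1 e2] eT].
    by rewrite inE cV bV; case/andP: acb.
  have := sT _ eT; rewrite inE /= => /and3P[/[dup] /ab h1 e1V /[dup] /ab h2 e2V lt].
  have := nc _ _ acT eT; apply: contra; rewrite /crossing /= => cr.
  have [e1a | ne] := eqVneq e1 a; last by move: ne; rewrite -val_eqE /=; lia.
  move: eT; rewrite e1a => aT; have := maxc e2 e2V _ aT; lia.
move=> c' [c'V ac'b ac'T c'bT]; apply: val_inj => /=.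
have [lt | gt | //] := ltngtP c c'.
  have := maxc c' c'V ac'b ac'T; lia.
have := nc _ _ acT c'bT; rewrite /crossing /=; lia.
Qed.

End Chords.

(** * Counting triangulations by the apex over a side *)

Section Count.
Variable N : nat.
Implicit Types (d e : 'I_N * 'I_N) (V : {set 'I_N}) (T : {set 'I_N * 'I_N}).

Lemma card_set_sum (X : finType) (P : pred X) : #|[set x | P x]| = (\sum_x P x)%N.
Proof. by rewrite -sum1dep_card big_mkcond. Qed.

Lemma card_exists_unique (X I : finType) (P : pred X) (R : X -> pred I) :
  (forall x, P x -> exists! i, R x i) ->
  #|[set x | P x]| = (\sum_i #|[set x | P x && R x i]|)%N.
Proof.
move=> ex; under [RHS]eq_bigr => i _ do rewrite card_set_sum.
rewrite exchange_big card_set_sum; apply: eq_bigr => x _ /=.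
case Px: (P x); last by rewrite big1.
have [i [Ri uniq_i]] := ex x Px.
rewrite (bigD1 i) //= Ri big1 // => j ne_ji.
by case Rj: (R x j) => //; rewrite (uniq_i j Rj) eqxx in ne_ji.
Qed.

(** Two successive cuts, along [(a, c)] and then along [(c, b)] in the outer part; what remains has
    only the vertices [a], [c], [b] and contributes a factor [1]. *)
Lemma card_cut_pair V a b (c : 'I_N) : a \in V -> b \in V -> c \in V -> (a < c < b)%N ->
  {in V, forall x : 'I_N, (a <= x <= b)%N} ->
  #|[set T | max_noncrossing (chords V) T && [&& (a, c) \in T & (c, b) \in T]]| =
  (#|[set T | max_noncrossing (chords (inside V (a, c))) T]| *
   #|[set T | max_noncrossing (chords (inside V (c, b))) T]|)%N.
Proof.
move=> aV bV cV acb ab; set W := outside V (a, c).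
have acC : (a, c) \in chords V by rewrite inE aV cV; case/andP: acb.
have cbW : (c, b) \in chords W by rewrite !inE /= cV bV; lia.
transitivity #|[set T | [&& max_noncrossing (chords V) T, (a, c) \in T,
   predT (T :&: chords (inside V (a, c))) & (c, b) \in T :&: chords W]]|.
  by apply: eq_card => T; rewrite in_set [RHS]in_set in_setI cbW andbT.
rewrite (card_chords_cut predT (fun T => (c, b) \in T) acC); congr muln.
  by apply: eq_card => T; rewrite !inE andbT.
transitivity #|[set T | [&& max_noncrossing (chords W) T, (c, b) \in T,
   predT (T :&: chords (inside W (c, b))) & predT (T :&: chords (outside W (c, b)))]]|.
  by apply: eq_card => T; rewrite in_set [RHS]in_set /= andbT.
rewrite (card_chords_cut predT predT cbW) [X in (_ * X)%N]card_max_noncrossing_trivial;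
  last first.
  have /subset_leq_card : outside W (c, b) \subset [set a; c; b].
    apply/subsetP => x; rewrite !inE /= -!val_eqE /= => /andP[/andP[/ab xab]]; lia.
  by move=> /leq_trans -> //; rewrite cardsU cards2 cards1; case: (_ != _) => /=; lia.
rewrite muln1; have -> : inside W (c, b) = inside V (c, b).
  by apply/setP => x; rewrite !inE /=; case: (x \in V) => //=; lia.
by apply: eq_card => T; rewrite !inE andbT.
Qed.

(** Segner's recurrence on the apex over the side joining the smallest and largest vertices. Two
    vertices form a single edge, counted by [C_0]. *)
Lemma card_max_noncrossing_chords V : (2 <= #|V|)%N ->
  #|[set T | max_noncrossing (chords V) T]| = catalan (#|V| - 2).
Proof.
elim: {V}_.+1 {-2}V (ltnSn #|V|) => // m IH V leV geV.
have [V3 | V3] := leqP #|V| 2.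
  have e2 : #|V| = 2%N.
    by lia.
  rewrite e2 /=.
  rewrite -[RHS](card_max_noncrossing_trivial (V := V) predT); last by lia.
  by apply: eq_card => T; rewrite in_set [RHS]in_set andbT.
have [x0 x0V] : exists x, x \in V by apply/set0Pn; rewrite -card_gt0; lia.
case: (@arg_minnP _ x0 (mem V) (fun i : 'I_N => i : nat) x0V) => a aV' mina.
case: (@arg_maxnP _ x0 (mem V) (fun i : 'I_N => i : nat) x0V) => b bV' maxb.
have {aV'} aV : a \in V by []. have {bV'} bV : b \in V by [].
have ab : {in V, forall x : 'I_N, (a <= x <= b)%N} by move=> x xV; rewrite mina //;
  apply: maxb.
pose A := [set c in V | (a < c < b)%N].
have ne_ab : (a < b)%N.
  rewrite ltnNge; apply/negP => le_ba; suff : (#|V| <= 1)%N by lia.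
  by apply/card_le1_eqP => x y /ab xab /ab yab; apply: val_inj => /=; lia.
have cardA : #|V| = #|A|.+2.
  rewrite (cardsD1 a) aV (cardsD1 b) !inE bV andbT -val_eqE /= (_ : _ != _) /=;
    last by lia.
  rewrite !add1n; congr _.+2; apply: eq_card => x; rewrite !inE -!val_eqE /=.
  by case: (boolP (x \in V)) => [/ab|_]; rewrite ?andbF ?andbT //=; lia.
rewrite cardA subn2 /=.
pose R T c := [&& c \in A, (a, c) \in T & (c, b) \in T].
have ex T : max_noncrossing (chords V) T -> exists! c, R T c.
  move=> mT; have [c [[cV acb aT bT] uc]] := max_noncrossing_apex mT aV bV ab V3.
  exists c; split; first by rewrite /R inE cV acb aT.
  by move=> c' /and3P[]; rewrite inE => /andP[c'V ac'b] aT' bT'; apply: uc.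
rewrite (card_exists_unique ex) (bigID (mem A)) /= [X in (_ + X)%N]big1 ?addn0;
  last first.
  by move=> c /negbTE cA; apply: eq_card0 => T; rewrite inE /R cA andbF.
(* An apex of rank [i] leaves [i + 2] vertices on its left and [#|A| + 1 - i] on its right, whence
   the factors [catalan i] and [catalan (#|A| - 1 - i)]. *)
have szl c : c \in A -> #|inside V (a, c)| = #|[set x in A | (x < c)%N]|.+2.
  rewrite inE => /andP[cV acb].
  rewrite (cardsD1 a) !inE aV (cardsD1 c) !inE cV -!val_eqE /= (_ : [&& _, _ & _]) /=;
    last by lia.
  rewrite (_ : (_ <= _)%N && _) /=; last by lia.
  rewrite !add1n; congr _.+2; apply: eq_card => x; rewrite !inE -!val_eqE /=.
  by case: (boolP (x \in V)) => [/ab|_]; rewrite ?andbF ?andbT //=; lia.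
have szr c : c \in A -> (#|[set x in A | (x < c)%N]|.+1 + #|inside V (c, b)| = #|A|.+2)%N.
  rewrite inE => /andP[cV acb].
  rewrite (cardsD1 c (inside _ _)) (cardsD1 b (inside V (c, b) :\ c)) !inE cV bV
      -!val_eqE /= (_ : [&& _, _ & _]) /=; last by lia.
  rewrite (_ : (_ <= _)%N && _) /=; last by lia.
  rewrite !add1n (cardsD1 c A) inE cV acb /= -(cardsID [set x : 'I_N | (x < c)%N] (A :\
      c)).
  have -> : (A :\ c) :&: [set x : 'I_N | (x < c)%N] = [set x in A | (x < c)%N].
    by apply/setP => x; rewrite !inE -!val_eqE /=; case: (x \in V);
      rewrite ?andbF ?andbT //=; lia.
  have -> : (A :\ c) :\: [set x : 'I_N | (x < c)%N] = inside V (c, b) :\ c :\ b.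
    apply/setP => x; rewrite !inE -!val_eqE /=.
    by case: (boolP (x \in V)) => [/ab|_]; rewrite ?andbF ?andbT //=; lia.
  by rewrite add1n addSn !addnS.
transitivity (\sum_(c in A) (fun i => catalan i * catalan (#|A|.-1 - i)) #|[set x in A
    | (x < c)%N]|)%N.
  apply: eq_bigr => c cA; have := szl c cA; have := szr c cA.
  move: (cA); rewrite inE => /andP[cV acb] er el.
  have arith (r s n : nat) : (r.+1 + s = n.+2 -> n.-1 - r = s - 2)%N by lia.
  rewrite /= (arith _ _ _ er) (_ : catalan #|[set x in A | (x < c)%N]| =
    catalan (#|inside V (a, c)| - 2)); last by rewrite el subn2.
  have ltl : (#|inside V (a, c)| < #|V|)%N.
    apply: proper_card; apply/properP; split; first by apply/subsetP => x;
      rewrite inE => /andP[].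
    by exists b; rewrite // inE bV /=; lia.
  have ltr : (#|inside V (c, b)| < #|V|)%N.
    apply: proper_card; apply/properP; split; first by apply/subsetP => x;
      rewrite inE => /andP[].
    by exists a; rewrite // inE aV /=; lia.
  have gel : (2 <= #|inside V (a, c)|)%N by rewrite el.
  have ger : (2 <= #|inside V (c, b)|)%N.
    have /subset_leq_card : [set c; b] \subset inside V (c, b).
      by apply/subsetP => x; rewrite !inE => /orP[] /eqP ->; rewrite ?cV ?bV /=; lia.
    by rewrite cards2 -val_eqE /= (_ : _ != _) //; lia.
  rewrite -!IH ?(leq_trans ltl) ?(leq_trans ltr) //.
  rewrite -(card_cut_pair aV bV cV acb ab).
  by apply: eq_card => T; rewrite in_set [RHS]in_set /R cA.
rewrite (sum_rank A (fun i => catalan i * catalan (#|A|.-1 - i))%N).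
by case: #|A| cardA => [|n] eA; [lia | rewrite catalan_segner].
Qed.

End Count.

(** * Pieces between parallel chords *)

(** Either no term is true or exactly one [r] is the first true one; this splits a count according
    to the first chord that occurs. *)
Lemma bool_sum_first (a : nat -> bool) (m n : nat) :
  ((\sum_(m <= r < n) a r == 0) +
   \sum_(m <= r < n) (a r && (\sum_(m <= i < r) a i == 0)) = 1)%N.
Proof.
have [lt_nm | ] := ltnP n m; first by rewrite !big_geq // ltnW.
elim: n => [|n IH]; first by rewrite leqn0 => /eqP ->; rewrite !big_geq.
rewrite leq_eqVlt => /orP[/eqP <-|]; first by rewrite !big_geq.
rewrite ltnS => le_mn; rewrite !big_nat_recr //= -[RHS](IH le_mn) addn_eq0.
by case: (a n); case: (_ == 0)%N; rewrite /= ?addn0 ?add0n ?addn1 ?add1n.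
Qed.

Lemma bool_sum_last (a : nat -> bool) (m n : nat) :
  ((\sum_(m <= r < n) a r == 0) +
   \sum_(m <= r < n) (a r && (\sum_(r.+1 <= i < n) a i == 0)) = 1)%N.
Proof.
have [lt_nm | ] := ltnP n m; first by rewrite !big_geq // ltnW.
elim: n => [|n IH]; first by rewrite leqn0 => /eqP ->; rewrite !big_geq.
rewrite leq_eqVlt => /orP[/eqP <-|]; first by rewrite !big_geq.
rewrite ltnS => le_mn;
  rewrite !(big_nat_recr n m) //= (@big_geq _ _ _ n.+1 n.+1) // andbT addn_eq0.
have e r : (m <= r < n)%N -> (a r && (\sum_(r.+1 <= i < n.+1) a i == 0)%N) =
   ~~ a n && (a r && (\sum_(r.+1 <= i < n) a i == 0)%N).
  move=> /andP[_ lt_rn]; rewrite big_nat_recr //= addn_eq0.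
  by case: (a n); case: (a r); rewrite /= ?andbF ?andbT.
rewrite (eq_big_nat _ _ (fun r hr => congr1 nat_of_bool (e r hr))).
case: (a n) => /=; first by rewrite andbF big1.
by rewrite andbT addn0 IH.
Qed.

Section Pieces.
Variables N' s : nat.
Hypothesis hs : (N' <= s <= N'.+1)%N.
Local Notation N := N'.+1.
Implicit Types (d e : 'I_N * 'I_N) (V : {set 'I_N}) (T : {set 'I_N * 'I_N}).

Definition chord (r : nat) : 'I_N * 'I_N := (inord r, inord (s - r)).

(* The polygon between the chords (p, s - p) and (q, s - q).  It has an odd
   number of vertices when the first pair is (0, N), of which only vertex 0
   exists, or when the second one degenerates to a vertex, 2 q = s. *)
Definition piece (p q : nat) : {set 'I_N} :=
  [set a : 'I_N | (p <= a <= q)%N || (s - q <= a <= s - p)%N].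

(** Only chords strictly between the ends count: an end is a side of the piece or degenerates to a
    vertex. *)
Definition num_chords (p q : nat) T : nat := (\sum_(p.+1 <= r < q) (chord r \in T))%N.

Definition num_triangulations_with (p q k : nat) : nat :=
  #|[set T | max_noncrossing (chords (piece p q)) T && (num_chords p q T == k)]|.

Definition num_triangulations (p q : nat) : nat :=
  #|[set T | max_noncrossing (chords (piece p q)) T]|.

Lemma card_piece p q : (p < q)%N -> (2 * q <= s)%N ->
  #|piece p q| = ((q.+1 - p) + ((minn (s - p) N').+1 - maxn (s - q) q.+1))%N.
Proof.
move=> lt_pq le_qs.
have card_itv n l u : (\sum_(a < n) ((l <= a) && (a < u)) = minn n u - l)%N.
  by elim: n => [|n IH]; [rewrite big_ord0 | rewrite big_ord_recr /= IH]; lia.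
rewrite card_set_sum.
(* The second arc starts after [q], so that vertex [q] is not counted twice when [2 * q = s], and
   stops at [N'], since vertex [s - p] is absent when [p = 0] and [s = N]. *)
transitivity (\sum_(a < N) ((p <= a) && (a < q.+1)) +
  \sum_(a < N) ((maxn (s - q) q.+1 <= a) && (a < (minn (s - p) N').+1)))%N; last first.
  by rewrite !card_itv; lia.
rewrite -big_split /=.
apply: eq_bigr => a _ /=; have := ltn_ord a; lia.
Qed.

Section Cut.
Variables p q r : nat.
Hypotheses (hr : (p < r < q)%N) (hq : (2 * q <= s)%N).

Lemma val_chord : ((chord r).1 = r :> nat) * ((chord r).2 = s - r :> nat)%N.
Proof. by rewrite /chord /= !inordK //; lia. Qed.

Lemma chord_in_piece : chord r \in chords (piece p q).
Proof. by rewrite !inE !val_chord; lia. Qed.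

Lemma inside_piece : inside (piece p q) (chord r) = piece r q.
Proof. by apply/setP => x; rewrite !inE !val_chord; have := ltn_ord x; lia. Qed.

Lemma outside_piece : outside (piece p q) (chord r) = piece p r.
Proof. by apply/setP => x; rewrite !inE !val_chord; have := ltn_ord x; lia. Qed.

Lemma num_chords_split T :
  num_chords p q T = (num_chords p r T + (chord r \in T) + num_chords r q T)%N.
Proof.
rewrite /num_chords (big_cat_nat _ (n := r)) //=; try lia.
by rewrite (big_ltn (m := r)) ?addnA //; lia.
Qed.

End Cut.

Lemma num_chordsI p q T : (2 * q <= s)%N ->
  num_chords p q (T :&: chords (piece p q)) = num_chords p q T.
Proof.
by move=> hq; apply: eq_big_nat => r hr; rewrite inE chord_in_piece // andbT.
Qed.

Lemma card_cut_piece p q r (Q1 Q2 : pred nat) :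
  (p < r < q)%N -> (2 * q <= s)%N ->
  #|[set T | max_noncrossing (chords (piece p q)) T &&
       [&& chord r \in T, Q1 (num_chords p r T) & Q2 (num_chords r q T)]]| =
  (#|[set T | max_noncrossing (chords (piece p r)) T && Q1 (num_chords p r T)]| *
   #|[set T | max_noncrossing (chords (piece r q)) T && Q2 (num_chords r q T)]|)%N.
Proof.
move=> hr hq; have rV := chord_in_piece hr hq.
rewrite mulnC -(inside_piece hr hq) -(outside_piece hr hq) -card_chords_cut //.
apply: eq_card => T;
  rewrite in_set [RHS]in_set (inside_piece hr hq) (outside_piece hr hq).
rewrite !num_chordsI //; last by lia.
by do 2!congr (_ && _); rewrite andbC.
Qed.

(** The piece before the first class chord is free of such chords, and the other [k] lie beyond
    it. *)
Lemma count_first p q k : (2 * q <= s)%N ->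
  num_triangulations_with p q k.+1 =
  (\sum_(p.+1 <= r < q)
     num_triangulations_with p r 0 * num_triangulations_with r q k)%N.
Proof.
move=> hq; rewrite /num_triangulations_with card_set_sum.
transitivity (\sum_T \sum_(p.+1 <= r < q) (max_noncrossing (chords (piece p q)) T &&
   [&& chord r \in T, num_chords p r T == 0 & num_chords r q T == k])%N)%N.
  apply: eq_bigr => T _; case: (max_noncrossing _ T) => /=; last by rewrite big1.
  have := bool_sum_first (fun r => chord r \in T) p.+1 q.
  rewrite -/(num_chords p q T).
  case: eqP => [n0 | /eqP n0] /=; rewrite ?n0 ?add0n ?add1n => e.
    move: e => [e]; apply/eqP; rewrite eq_sym big_nat_cond big1 // => r /andP[hr _].
    rewrite (num_chords_split hr hq) in n0.
    by case: (chord r \in T) n0 => //=; lia.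
  rewrite -[LHS]muln1 -e big_distrr /=; apply: eq_big_nat => r hr.
  rewrite -/(num_chords p r T) (num_chords_split hr hq).
  by case: (chord r \in T) => //=; case: (num_chords p r T) => [|m];
    rewrite /= ?muln0 ?muln1 ?addSn ?add0n ?eqSS.
rewrite exchange_big; apply: eq_big_nat => r hr.
by rewrite -(card_cut_piece (pred1 0%N) (pred1 k) hr hq) card_set_sum.
Qed.

(** Since the totals are Catalan numbers, this determines the chord-free counts recursively. *)
Lemma total_first p q : (2 * q <= s)%N ->
  num_triangulations p q =
  (num_triangulations_with p q 0 +
   \sum_(p.+1 <= r < q) num_triangulations_with p r 0 * num_triangulations r q)%N.
Proof.
move=> hq; rewrite /num_triangulations /num_triangulations_with !card_set_sum.
transitivity (\sum_T (
   (max_noncrossing (chords (piece p q)) T && (num_chords p q T == 0)) +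
   \sum_(p.+1 <= r < q) (max_noncrossing (chords (piece p q)) T &&
   [&& chord r \in T, num_chords p r T == 0 & predT (num_chords r q T)])%N))%N.
  apply: eq_bigr => T _; case: (max_noncrossing _ T) => /=; last by rewrite big1.
  rewrite -[LHS](bool_sum_first (fun r => chord r \in T) p.+1 q); congr (_ + _)%N.
  by apply: eq_big_nat => r _; rewrite andbT.
rewrite big_split exchange_big; congr (_ + _)%N; apply: eq_big_nat => r hr.
rewrite -card_set_sum (card_cut_piece (pred1 0%N) predT hr hq); congr (_ * _)%N.
by apply: eq_card => T; rewrite in_set [RHS]in_set andbT.
Qed.

(** Serves the pieces whose first end is a vertex: the chord-free factor in the sum then lies
    between two chords. *)
Lemma total_last p q : (2 * q <= s)%N ->
  num_triangulations p q =
  (num_triangulations_with p q 0 +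
   \sum_(p.+1 <= r < q) num_triangulations p r * num_triangulations_with r q 0)%N.
Proof.
move=> hq; rewrite /num_triangulations /num_triangulations_with !card_set_sum.
transitivity (\sum_T (
   (max_noncrossing (chords (piece p q)) T && (num_chords p q T == 0)) +
   \sum_(p.+1 <= r < q) (max_noncrossing (chords (piece p q)) T &&
   [&& chord r \in T, predT (num_chords p r T) & num_chords r q T == 0])%N))%N.
  apply: eq_bigr => T _; case: (max_noncrossing _ T) => /=; last by rewrite big1.
  rewrite -[LHS](bool_sum_last (fun r => chord r \in T) p.+1 q); congr (_ + _)%N.
rewrite big_split exchange_big; congr (_ + _)%N; apply: eq_big_nat => r hr.
rewrite -card_set_sum (card_cut_piece predT (pred1 0%N) hr hq); congr (_ * _)%N.
by apply: eq_card => T; rewrite in_set [RHS]in_set andbT.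
Qed.

End Pieces.

(** * Rotation *)

(** By finiteness [F] permutes [P]; as it respects crossings, it permutes the maximal sets. *)
Lemma card_max_noncrossing_transport (N : nat) (P : {set 'I_N * 'I_N})
    (F : 'I_N * 'I_N -> 'I_N * 'I_N) (Q Q' : pred {set 'I_N * 'I_N}) :
  {in P, forall d, F d \in P} -> {in P &, injective F} ->
  {in P &, forall d e, crossing (F d) (F e) = crossing d e} ->
  (forall T : {set 'I_N * 'I_N}, T \subset P -> Q T = Q' (F @: T)) ->
  #|[set T | max_noncrossing P T && Q T]| = #|[set T | max_noncrossing P T && Q' T]|.
Proof.
move=> FP injF crF eQ.
have FPP : F @: P = P.
  apply/eqP; rewrite eqEcard card_in_imset // leqnn andbT.
  by apply/subsetP => _ /imsetP[d dP ->]; apply: FP.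
have memF (T : {set 'I_N * 'I_N}) d : T \subset P -> d \in P -> (F d \in F @: T) = (d
    \in T).
  move=> /subsetP sT dP; apply/imsetP/idP => [[e eT eq]|dT]; last by exists d.
  by rewrite (injF _ _ dP (sT _ eT) eq).
have mF (T : {set 'I_N * 'I_N}) : T \subset P -> max_noncrossing P (F @: T) =
    max_noncrossing P T.
  move=> sT; have crT d : d \in P ->
      [forall e in F @: T, ~~ crossing (F d) e] = [forall e in T, ~~ crossing d e].
    move=> dP; apply/forall_inP/forall_inP => H e.
      by move=> eT; rewrite -(crF d e dP (subsetP sT e eT)); apply: H; apply: imset_f.
    by move=> /imsetP[x xT ->]; rewrite (crF d x dP (subsetP sT x xT)); apply: H.
  apply/max_noncrossingP/max_noncrossingP => H d.
    case: (boolP (d \in P)) => [dP|dP]; last by apply/negbTE; apply: contra dP;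
      apply/subsetP.
    by rewrite -memF // H FP // crT.
  case: (boolP (d \in P)) => [|dP].
    by rewrite -{1}FPP => /imsetP[x xP ->]; rewrite memF // crT // H xP.
  apply/negbTE; apply: contra dP => /imsetP[x xT ->]; exact/FP/(subsetP sT).
have injI : {in [set T | max_noncrossing P T && Q T] &, injective (fun T : {set 'I_N *
    'I_N} => F @: T)}.
  move=> T T';
    rewrite !in_set => /andP[/max_noncrossing_sub sT _] /andP[/max_noncrossing_sub sT'
      _] e.
  apply/setP => d; case: (boolP (d \in P)) => [dP|dP];
    first by rewrite -(memF T) // -(memF T') // e.
  have out (S : {set 'I_N * 'I_N}) : S \subset P -> (d \in S) = false.
    by move=> sS; apply/negbTE; apply: contra dP; apply/subsetP.
  by rewrite !out.
rewrite -(card_in_imset injI); apply: eq_card => T'; rewrite [RHS]in_set.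
apply/imsetP/andP => [[T] | [mT' qT']].
  by rewrite in_set => /andP[mT qT] ->; have sT := max_noncrossing_sub mT;
    rewrite mF // -eQ.
have sT := max_noncrossing_sub mT'.
pose T := [set d in P | F d \in T'].
have TP : T \subset P by apply/subsetP => d; rewrite inE => /andP[].
have eT : T' = F @: T.
  apply/setP => d; apply/idP/imsetP => [dT|[x]]; last by rewrite inE => /andP[_ xT] ->.
  have := subsetP sT d dT; rewrite -{1}FPP => /imsetP[x xP e].
  by exists x => //; rewrite inE xP -e.
by exists T => //; rewrite in_set -mF // -eT mT' eQ // -eT.
Qed.

Lemma triangulationE (N : nat) (T : {set 'I_N * 'I_N}) :
  triangulation T = max_noncrossing [set d | diagonal d] T.
Proof.
apply/and3P/idP => [[/forall_inP dT /forall_inP ncT /forallP maxT] | mT].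
  apply/max_noncrossingP => d; rewrite inE; apply/idP/andP => [dinT|[dd ndT]].
    by split; [apply: dT | apply: ncT].
  apply/negPn/negP => dnT; have := maxT d; rewrite dd dnT /= => /negP; apply.
  move/forall_inP: ndT => ndT; apply/forall_inP => e /setU1P[->|eT].
    by apply/forall_inP => x /setU1P[->|/ndT//]; rewrite crossing_irr.
  apply/forall_inP => x /setU1P[->|xT].
    by rewrite crossing_sym ndT.
  by move/forall_inP: (ncT e eT); apply.
split.
- by apply/forall_inP => d /(subsetP (max_noncrossing_sub mT)); rewrite inE.
- apply/forall_inP => d dT; apply/forall_inP => e eT; exact: (max_noncrossing_nc mT).
apply/forallP => d; apply/implyP => /andP[dd dnT]; apply: contra dnT => /forall_inP nc.
apply: (max_noncrossing_max mT); first by rewrite inE.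
by move=> e eT; move/forall_inP: (nc d (setU11 _ _)); apply; rewrite inE eT orbT.
Qed.

Section Rotation.
Variable N' : nat.
Local Notation N := N'.+1.
Implicit Types (d e : 'I_N * 'I_N) (T : {set 'I_N * 'I_N}).

(** The rotation [x -> x - 1] modulo [N]. Vertex [0] becomes [N'], the largest label, so the pair is
    reordered. *)
Definition rot_chord d : 'I_N * 'I_N :=
  if ((d.1 : nat) == 0)%N then (inord d.2.-1, inord N') else (inord d.1.-1, inord d.2.-1).

Lemma rot_chordE d : diagonal d ->
  if ((d.1 : nat) == 0)%N
  then (rot_chord d).1 = d.2.-1 :> nat /\ (rot_chord d).2 = N' :> nat
  else (rot_chord d).1 = d.1.-1 :> nat /\ (rot_chord d).2 = d.2.-1 :> nat.
Proof.
case: d => a b; rewrite /diagonal /= => dd.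
have := ltn_ord a; have := ltn_ord b; move=> hb ha.
by case: ifP => a0; rewrite /rot_chord /= a0 /=; split; rewrite !inordK //; lia.
Qed.

Lemma diagonal_rot d : diagonal d -> diagonal (rot_chord d).
Proof.
move=> dd; have := rot_chordE dd; move: dd; rewrite /diagonal.
have := ltn_ord d.1; have := ltn_ord d.2.
by case: ifP => a0 hb ha dd [-> ->]; lia.
Qed.

Lemma rot_chord_inj : {in [set d : 'I_N * 'I_N | diagonal d] &, injective rot_chord}.
Proof.
move=> d e; rewrite !inE => dd de eq.
have := rot_chordE dd; have := rot_chordE de; rewrite eq.
case: d e dd de {eq} => [a b] [c x]; rewrite /diagonal /= => dd de.
have := ltn_ord a; have := ltn_ord b; have := ltn_ord c; have := ltn_ord x.
move=> hx hc hb ha; do 2!case: ifP => ?; move=> [-> ->] [h1 h2];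
  by congr pair; apply: val_inj => /=; lia.
Qed.

Lemma crossing_rot : {in [set d : 'I_N * 'I_N | diagonal d] &,
  forall d e, crossing (rot_chord d) (rot_chord e) = crossing d e}.
Proof.
move=> d e; rewrite !inE => dd de.
have := rot_chordE dd; have := rot_chordE de; rewrite /crossing.
case: d e dd de => [a b] [c x]; rewrite /diagonal /= => dd de.
have := ltn_ord a; have := ltn_ord b; have := ltn_ord c; have := ltn_ord x.
move=> hx hc hb ha; do 2!case: ifP => ?; move=> [-> ->] [-> ->]; lia.
Qed.

(** The congruence allows the sums [e] and [N + e]. For a diagonal the first forces [d.1 = 0] and
    the second [d.1 > 0], and the rotation sends both to the single sum [N' + e - 1]. *)
Lemma card_rot_chord T (e : nat) : T \subset [set d | diagonal d] -> (1 <= e <= 2)%N ->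
    (2 <= N')%N ->
  num_parallel 0 e T = #|[set d in rot_chord @: T | (d.1 + d.2 == N' + e - 1)%N]|.
Proof.
move=> sT he hN; rewrite /num_parallel.
have inj : {in [set d in T | (((d.1 : nat) + d.2) %% N == (0 + e) %% N)%N] &, injective
    rot_chord}.
  by move=> d d'; rewrite !inE => /andP[/(subsetP sT) dT _] /andP[/(subsetP sT) dT' _];
    apply: rot_chord_inj.
have modE x : (x %% N == (0 + e) %% N)%N = (x %% N == e)%N by rewrite add0n
    (@modn_small e) //; lia.
have {}modE x : (x < 2 * N)%N -> (x %% N == (0 + e) %% N)%N = (x == e)%N || (x == N +
    e)%N.
  move=> lt_x; rewrite modE; have [lt_xN|le_Nx] := ltnP x N;
    first by rewrite modn_small //; lia.
  by rewrite -(subnK le_Nx) modnDr modn_small; lia.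
have par d : d \in T -> (((d.1 : nat) + d.2) %% N == (0 + e) %% N)%N =
    ((rot_chord d).1 + (rot_chord d).2 == N' + e - 1)%N.
  move=> /(subsetP sT); rewrite inE => dd; have := rot_chordE dd.
  case: d dd => [a b]; rewrite /diagonal /= => dd.
  have := ltn_ord a; have := ltn_ord b => hb ha; case: ifP => ? [-> ->]; rewrite modE;
    lia.
rewrite -(card_in_imset inj); apply: eq_card => d; rewrite [RHS]in_set.
apply/imsetP/andP => [[x]|[/imsetP[x xT ->] hx]].
  by rewrite in_set => /andP[xT hx] ->; rewrite imset_f // -par.
by exists x => //; rewrite in_set xT par.
Qed.

Variable s : nat.
Hypothesis hs : (N' <= s <= N'.+1)%N.

(** The first endpoint [r] determines the chord. The value [0] gives a side or no chord at all, and
    [s./2] gives a side or a single vertex, which leaves [0 < r < s./2]. *)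
Lemma card_sum_diagonals T : T \subset [set d | diagonal d] ->
  #|[set d in T | (d.1 + d.2 == s)%N]| = num_chords s 0 s./2 T.
Proof.
move=> sT; rewrite /num_chords.
have inj : {in [set d in T | (d.1 + d.2 == s)%N] &, injective fst}.
  move=> [a b] [c x]; rewrite !in_set /= => /andP[_ h1] /andP[_ h2] e.
  congr pair => //; apply: val_inj => /=; rewrite e in h1; lia.
rewrite -(card_in_imset inj).
have -> : [set d.1 | d in [set d in T | (d.1 + d.2 == s)%N]] =
    [set r : 'I_N | (0 < r < s./2)%N && (chord N' s r \in T)].
  apply/setP => r; rewrite [RHS]in_set; apply/imsetP/andP => [[d]|[hr cT]].
    case: d => a b; rewrite in_set => /andP[dT ds] ->; have := subsetP sT _ dT.
    rewrite inE /diagonal /= => dd; rewrite /= in ds.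
    have := ltn_ord a; have := ltn_ord b => hb ha.
    split; first by lia.
    suff -> : chord N' s a = (a, b) by [].
    by rewrite /chord; congr pair; apply: val_inj; rewrite /= inordK; lia.
  have [e1 e2] : (chord N' s r).1 = r :> nat /\ (chord N' s r).2 = (s - r)%N :> nat.
    have hq : (2 * s./2 <= s)%N by lia.
    by rewrite !(val_chord hs hr hq).
  exists (chord N' s r); first by rewrite in_set cT e1 e2 ; lia.
  by apply: val_inj.
rewrite card_set_sum -(big_mkord xpredT (fun r => ((0 < r < s./2)%N && (chord N' s r
    \in T)) : nat)).
rewrite [RHS](big_nat_widen _ _ N); last by lia.
rewrite [RHS](big_nat_widenl _ 0) // [RHS]big_mkcond; apply: eq_bigr => r _ /=.
by rewrite andbC; case: ((r < s./2)%N); case: (0 < r)%N; rewrite ?andbF ?andbT.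
Qed.

(** Rotation replaces parallelism by the sum [s]. Adjoining the set [S] of sides multiplies the
    count by [1], because sides cross nothing. *)
Lemma f_count (e k : nat) : (1 <= e <= 2)%N -> (2 <= N')%N -> s = (N' + e - 1)%N ->
  f N 0 e k = num_triangulations_with N' s 0 s./2 k.
Proof.
move=> he hN es.
pose Dg := [set d : 'I_N * 'I_N | diagonal d].
pose S := [set d : 'I_N * 'I_N | (d.1 < d.2)%N && ~~ diagonal d].
have ePiece : piece N' s 0 s./2 = setT.
  by apply/setP => a; rewrite !inE; have := ltn_ord a; lia.
have eDS : chords (piece N' s 0 s./2) = Dg :|: S.
  by apply/setP => d; rewrite ePiece !inE /= /diagonal; lia.
have ncS : forall d d', d \in Dg -> d' \in S -> ~~ crossing d d'.
  move=> [a b] [c x]; rewrite !inE /crossing /diagonal /=.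
  have := ltn_ord a; have := ltn_ord b; have := ltn_ord c; have := ltn_ord x; lia.
have ncSS : {in S &, forall d d', ~~ crossing d d'}.
  move=> [a b] [c x]; rewrite !inE /crossing /diagonal /=.
  have := ltn_ord a; have := ltn_ord b; have := ltn_ord c; have := ltn_ord x; lia.
pose Q T := (num_chords s 0 s./2 T == k)%N.
transitivity #|[set T | max_noncrossing Dg T && Q T]|.
  transitivity #|[set T : {set 'I_N * 'I_N} | max_noncrossing Dg T && (num_parallel 0 e
      T == k)]|.
    by apply: eq_card => T; rewrite in_set [RHS]in_set triangulationE.
  apply: (card_max_noncrossing_transport (F := rot_chord)).
  - by move=> d; rewrite !inE => /diagonal_rot.
  - exact: rot_chord_inj.
  - exact: crossing_rot.
  move=> T sT; rewrite card_rot_chord // -es card_sum_diagonals //.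
  by apply/subsetP => _ /imsetP[d /(subsetP sT) + ->]; rewrite !inE => /diagonal_rot.
have S1 : #|[set T | max_noncrossing S T && predT T]| = 1%N.
  apply/eqP/cards1P; exists S; apply/setP => T.
  by rewrite in_set max_noncrossing_trivial // andbT in_set1.
rewrite -[LHS]muln1 -S1 -(card_max_noncrossingU _ _ ncS) /num_triangulations_with eDS.
apply: eq_card => T; rewrite in_set [RHS]in_set andbT; congr (_ && _).
rewrite /Q; congr (_ == _); apply: eq_big_nat => r hr; rewrite in_setI.
rewrite (_ : chord N' s r \in Dg) ?andbT // inE /diagonal.
have hq : (2 * s./2 <= s)%N by lia.
by rewrite !(val_chord hs hr hq); lia.
Qed.

End Rotation.

(** * Generating functions *)

(* mid_coef i and end_coef i count the chord-free triangulations of a piece of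
   width i whose ends are both chords, resp. exactly one of which is a vertex. *)
Definition mid_coef (i : nat) : int :=
  if i is 0 then 0 else 2 * (catalan (2 * i - 1))%:Z.

Definition end_coef (i : nat) : int :=
  if i is 0 then 0
  else (2 ^ (2 * i - 1) * catalan (i - 1))%N%:Z - (catalan (2 * i - 1))%:Z.

(** Has the shape of [total_first], for a piece of width [d] between two chords. *)
Lemma catalan_even_split d : (0 < d)%N ->
  (catalan (2 * d))%:Z =
  mid_coef d + \sum_(1 <= i < d) mid_coef i * (catalan (2 * (d - i)))%:Z.
Proof.
case: d => // d _; rewrite catalan_double Posz_sum big_ord_recr /= addrC; congr (_ + _).
  by rewrite subnn muln1 PoszM; congr (_ * (catalan _)%:Z); lia.
rewrite big_add1 big_mkord; apply: eq_bigr => i _; rewrite !PoszM /=.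
by congr (_ * (catalan _)%:Z * (catalan _)%:Z); lia.
Qed.

(** For [d = m + 1] this is twice [C_(2m+1) = 4^m C_m + S], where [S] sums over pairs of odd
    indices, with one copy of [C_(2m+1)] moved into [end_coef]. *)
Lemma catalan_odd_split d : (0 < d)%N ->
  (catalan (2 * d - 1))%:Z =
  end_coef d + \sum_(1 <= i < d) mid_coef i * (catalan (2 * (d - i) - 1))%:Z.
Proof.
case: d => // m _; rewrite big_add1 big_mkord /= subSS subn0.
rewrite (_ : 2 * m.+1 - 1 = (2 * m).+1)%N; last by lia.
have := catalan_doubleS m; rewrite catalan_even_convolution => e.
have -> : \sum_(i < m) 2 * (catalan (2 * i.+1 - 1))%:Z * (catalan (2 * (m - i) - 1))%:Z =
   2 * (\sum_(i < m) catalan (2 * i).+1 * catalan (2 * (m - i)).-1)%N%:Z.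
  rewrite Posz_sum mulr_sumr; apply: eq_bigr => i _; rewrite PoszM mulrA.
  by congr (_ * (catalan _)%:Z * (catalan _)%:Z); lia.
rewrite expnS expnM (_ : 2 ^ 2 = 4)%N //.
move: e; set S := (\sum_(i < m) _)%N; set c := catalan _; set x := (4 ^ m)%N; move=> e.
rewrite e; move: S c e => S c e; rewrite !(PoszM, PoszD); ring.
Qed.

Lemma sum_shift (R : nmodType) (p q : nat) (F : nat -> R) :
  \sum_(p.+1 <= r < q) F r = \sum_(1 <= i < q - p) F (i + p)%N.
Proof. by rewrite -add1n big_addn. Qed.

(** * Chord-free counts for the three kinds of pieces *)

Section CountPieces.
Variables N' s : nat.
Hypothesis hs : (N' <= s <= N'.+1)%N.

(** A piece of width [w = q - p] has [2w + 2] vertices here; a degenerate end removes one, whence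
    the index [2w - 1] in the other two cases. *)
Lemma total_mid p q : (p < q)%N -> (2 * q < s)%N -> (s - p <= N')%N ->
  num_triangulations N' s p q = catalan (2 * (q - p)).
Proof.
move=> pq qs ps; have e := card_piece hs pq (ltnW qs).
by rewrite /num_triangulations card_max_noncrossing_chords e; [congr catalan|]; lia.
Qed.

Lemma total_last_end p q : (p < q)%N -> (2 * q = s)%N -> (s - p <= N')%N ->
  num_triangulations N' s p q = catalan (2 * (q - p) - 1).
Proof.
move=> pq qs ps; have e : #|piece N' s p q| = _ := card_piece hs pq (eq_leq qs).
by rewrite /num_triangulations card_max_noncrossing_chords e; [congr catalan|]; lia.
Qed.

Lemma total_first_end q : (0 < q)%N -> (2 * q < s)%N -> s = N'.+1 ->
  num_triangulations N' s 0 q = catalan (2 * q - 1).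
Proof.
move=> pq qs ps; have e := card_piece hs pq (ltnW qs).
by rewrite /num_triangulations card_max_noncrossing_chords e; [congr catalan|]; lia.
Qed.

(** [total_first] and [catalan_even_split] are the same recurrence, with equal sums by induction on
    the width; cancelling these leaves the unknown term. *)
Lemma count_mid p q : (p < q)%N -> (2 * q < s)%N -> (s - p <= N')%N ->
  (num_triangulations_with N' s p q 0)%:Z = mid_coef (q - p).
Proof.
move: {2}(q - p)%N (leqnn (q - p)) => m; elim/ltn_ind: m p q => m IH p q le_m pq qs ps.
have := total_first hs p (ltnW qs); rewrite total_mid // => /(congr1 Posz).
rewrite catalan_even_split ?subn_gt0 // PoszD Posz_sum [X in _ = _ + X -> _]sum_shift.
rewrite [X in _ = _ + X -> _](eq_big_nat _ _ (F2 := fun i => mid_coef i * (catalan (2 *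
    (q - p - i)))%:Z)).
  by move=> e; apply: (addIr _ (esym e)).
move=> i hi; rewrite PoszM (IH (q - p).-1) ?total_mid; try lia.
by congr (mid_coef _ * (catalan _)%:Z); lia.
Qed.

Lemma count_last_end p q : (p < q)%N -> (2 * q = s)%N -> (s - p <= N')%N ->
  (num_triangulations_with N' s p q 0)%:Z = end_coef (q - p).
Proof.
move=> pq qs ps.
have := total_first hs p (eq_leq qs); rewrite total_last_end // => /(congr1 Posz).
rewrite catalan_odd_split ?subn_gt0 // PoszD Posz_sum [X in _ = _ + X -> _]sum_shift.
rewrite [X in _ = _ + X -> _](eq_big_nat _ _ (F2 := fun i => mid_coef i * (catalan (2 *
    (q - p - i) - 1))%:Z)).
  by move=> e; apply: (addIr _ (esym e)).
move=> i hi; rewrite PoszM count_mid ?total_last_end; try lia.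
by congr (mid_coef _ * (catalan _)%:Z); lia.
Qed.

Lemma count_first_end q : (0 < q)%N -> (2 * q < s)%N -> s = N'.+1 ->
  (num_triangulations_with N' s 0 q 0)%:Z = end_coef q.
Proof.
move=> pq qs ps.
have := total_last hs 0 (ltnW qs); rewrite total_first_end // => /(congr1 Posz).
rewrite catalan_odd_split // PoszD Posz_sum.
(* Reversal makes the summation index the width of the chord-free piece. *)
rewrite [X in _ = _ + X -> _]big_nat_rev /=.
rewrite [X in _ = _ + X -> _](eq_big_nat _ _ (F2 := fun i => mid_coef i * (catalan (2 *
    (q - i) - 1))%:Z)).
  by move=> e; apply: (addIr _ (esym e)).
move=> i hi; rewrite mulrC PoszM count_mid ?total_first_end; try lia.
by congr ((catalan _)%:Z * mid_coef _); lia.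
Qed.

End CountPieces.

Lemma coefM_inner (R : nzRingType) (A B : {poly R}) d : A`_0 = 0 -> B`_0 = 0 ->
  (0 < d)%N -> (A * B)`_d = \sum_(1 <= i < d) A`_i * B`_(d - i).
Proof.
move=> A0 B0; case: d => // d _;
  rewrite coefM big_ord_recl A0 mul0r add0r big_ord_recr /=.
rewrite /bump /= add1n subnn B0 mulr0 addr0 big_add1 big_mkord.
by apply: eq_bigr => i _.
Qed.

Section Coefficients.
Variable n : nat.

Definition mid_poly : {poly int} := \poly_(i < n.+1) mid_coef i.
Definition end_poly : {poly int} := \poly_(i < n.+1) end_coef i.

Lemma coef_mid i : (i <= n)%N -> mid_poly`_i = mid_coef i.
Proof. by move=> le_i; rewrite coef_poly ltnS le_i. Qed.

Lemma coef_end i : (i <= n)%N -> end_poly`_i = end_coef i.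
Proof. by move=> le_i; rewrite coef_poly ltnS le_i. Qed.

(** Each piece cut off at its first chord gives a factor [mid_poly]; [s - p <= N'] makes the first
    end a genuine segment. The last end is the side [(s./2, s./2 + 1)] for odd [s] and the vertex
    [s./2] for even [s]. *)
Lemma count_coef (N' s p k : nat) : (N' <= s <= N'.+1)%N ->
  (p < s./2)%N -> (s./2 <= n)%N -> (s - p <= N')%N ->
  (num_triangulations_with N' s p s./2 k)%:Z =
  (mid_poly ^+ k * (if odd s then mid_poly else end_poly))`_(s./2 - p).
Proof.
move=> hs hp hn hN; elim: k p hp hN => [|k IH] p hp hN.
  rewrite expr0 mul1r; case: ifP => odd_s.
    by rewrite coef_mid ?count_mid //; lia.
  by rewrite coef_end ?count_last_end //; lia.
rewrite exprS -mulrA coefM_inner ?subn_gt0 //; last first.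
- by rewrite coef0M; case: ifP => _; rewrite ?coef_mid ?coef_end ?mulr0.
- by rewrite coef_mid.
rewrite (count_first hs); last by lia.
rewrite Posz_sum sum_shift; apply: eq_big_nat => i hi.
rewrite PoszM count_mid ?IH ?coef_mid; try lia.
by congr (mid_coef _ * _`_ _); lia.
Qed.

(** Here [s] is the number of vertices and both ends are vertices. With at least one chord, the
    first and last pieces are distinct, and each has one degenerate end. *)
Lemma count_coef_first (s k : nat) : ~~ odd s -> (2 <= s)%N -> (s./2 <= n)%N ->
  (num_triangulations_with s.-1 s 0 s./2 k.+1)%:Z = (end_poly * (mid_poly ^+ k *
      end_poly))`_(s./2).
Proof.
move=> ev s2 hn; have hs : (s.-1 <= s <= s.-1.+1)%N by lia.
rewrite coefM_inner ?coef_end //; try lia; last by rewrite coef0M coef_end // mulr0.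
rewrite (count_first hs); last by lia.
rewrite Posz_sum; apply: eq_big_nat => i hi.
rewrite PoszM count_first_end ?coef_end; try lia.
by rewrite count_coef ?(negbTE ev) //; lia.
Qed.

(** Distributing the product lists all tuples, and the exponent of ['X] records their sum;
    [a j 0 = 0] kills tuples with a zero part. *)
Lemma sum_compositions (r m : nat) (a : 'I_r -> nat -> int) : (forall j, a j 0%N = 0) ->
  \sum_(c : {ffun 'I_r -> 'I_n.+1} | composition m c) \prod_(j < r) a j (c j) =
  (\prod_(j < r) \poly_(i < n.+1) a j i)`_m.
Proof.
move=> a0; under [in RHS]eq_bigr => j _ do rewrite poly_def.
rewrite bigA_distr_bigA coef_sum big_mkcond; apply: eq_bigr => c _.
rewrite scaler_prod -(big_morph _ (exprD ('X : {poly int})) (expr0 _)) coefZ coefXn.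
rewrite /composition eq_sym; case: forallP => [_|/forallP]; last first.
  rewrite negb_forall => /existsP[j]; rewrite -eqn0Ngt => /eqP cj.
  have -> : \prod_(i < r) a i (c i) = 0 by apply/eqP/prodf_eq0; exists j;
    rewrite // cj a0.
  by rewrite mul0r.
by case: (_ == _); rewrite ?mulr1 ?mulr0.
Qed.

End Coefficients.

Lemma mid_coef_pos i : (0 < i)%N -> mid_coef i = 2 * (catalan (2 * i - 1))%:Z.
Proof. by case: i. Qed.

Lemma end_coef_pos i : (0 < i)%N -> end_coef i =
  (2 ^ (2 * i - 1) * catalan (i - 1))%N%:Z - (catalan (2 * i - 1))%:Z.
Proof. by case: i. Qed.

Theorem theorem4 :
  (forall n k : nat, (2 <= n)%N -> (1 <= k)%N ->
     (f (2 * n) 0 1 k)%:Z =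
     \sum_(c : {ffun 'I_k.+1 -> 'I_n.+1} | composition (n - 1)%N c)
        (2 ^+ k.+1 * \prod_(j < k.+1) (catalan (2 * c j - 1)%N)%:Z)) /\
  (forall n k : nat, (2 <= n)%N -> (1 <= k)%N ->
     (f (2 * n) 0 2 k)%:Z =
     \sum_(c : {ffun 'I_k.+1 -> 'I_n.+1} | composition n c)
        (2 ^+ k.-1
         * ((2 ^ (2 * c ord0 - 1) * catalan (c ord0 - 1))%N%:Z
            - (catalan (2 * c ord0 - 1)%N)%:Z)
         * ((2 ^ (2 * c (inord 1) - 1) * catalan (c (inord 1) - 1))%N%:Z
            - (catalan (2 * c (inord 1) - 1)%N)%:Z)
         * \prod_(j < k.+1 | (2 <= j)%N) (catalan (2 * c j - 1)%N)%:Z)) /\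
  (forall n k : nat, (1 <= n)%N -> (1 <= k)%N ->
     (f (2 * n + 1) 0 1 k)%:Z =
     \sum_(c : {ffun 'I_k.+1 -> 'I_n.+1} | composition n c)
        (2 ^+ k
         * ((2 ^ (2 * c ord0 - 1) * catalan (c ord0 - 1))%N%:Z
            - (catalan (2 * c ord0 - 1)%N)%:Z)
         * \prod_(j < k.+1 | (1 <= j)%N) (catalan (2 * c j - 1)%N)%:Z)).
Proof.
split; [|split] => n k hn hk.
(* [N = 2n] and [e = 1] give odd [s = 2n - 1]: all [k + 1] pieces lie between two segments, and
   their widths add up to [s./2 = n - 1]. *)
- pose s := (2 * n - 1)%N.
  rewrite (_ : 2 * n = s.+1)%N; last by lia.
  rewrite (@f_count s s) //; try lia.
  rewrite (@count_coef n) //; try lia.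
  rewrite (_ : odd s = true) -?exprSr; last by lia.
  have := @sum_compositions n k.+1 (n - 1) (fun _ => mid_coef) (fun=> erefl).
  rewrite prodr_const card_ord -/(mid_poly n) subn0 (_ : s./2 = n - 1)%N => [<-|];
    last by lia.
  apply: eq_bigr => c /andP[/forallP cpos _].
  under eq_bigr => j _ do rewrite mid_coef_pos //.
  by rewrite big_split /= prodr_const card_ord.
(* [e = 2] gives [s = N = 2n]: the two extreme pieces end in a vertex, and commutativity gives their
   factors the indices [0] and [1]. *)
- case: k hk => // k _; pose s := (2 * n)%N.
  rewrite -[(2 * n)%N]/s (_ : s = s.-1.+1)%N; last by lia.
  rewrite (@f_count s.-1 s); try lia.
  rewrite (@count_coef_first n); try lia.
  have := @sum_compositions n k.+2 n (fun j => if (j < 2)%N then end_coef else mid_coef).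
  rewrite !big_ord_recl /= prodr_const card_ord -/(mid_poly n) -/(end_poly n).
  rewrite (_ : s./2 = n)%N; last by lia.
  rewrite [end_poly n * mid_poly n ^+ k]mulrC => <-; last by move=> j; case: ifP.
  apply: eq_bigr => c /andP[/forallP cpos _].
  rewrite !big_ord_recl /= !end_coef_pos //.
  have -> : lift ord0 ord0 = inord 1 :> 'I_k.+2 by apply: val_inj; rewrite /= inordK.
  rewrite [in RHS]big_mkcond !big_ord_recl /= !mul1r.
  under eq_bigr => j _ do rewrite mid_coef_pos //.
  by rewrite big_split /= prodr_const card_ord; ring.
(* [N = 2n + 1] and [e = 1] give [s = 2n]: only the last piece ends in a vertex, and its factor is
   moved to index [0]. *)
pose s := (2 * n)%N.
rewrite -[(2 * n)%N]/s addn1; case: k hk => // k _.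
rewrite (@f_count s s) //; try lia.
rewrite (@count_coef n) //; try lia.
rewrite (_ : odd s = false); last by lia.
have := @sum_compositions n k.+2 n (fun j => if (j < 1)%N then end_coef else mid_coef).
rewrite !big_ord_recl /= prodr_const card_ord -/(mid_poly n) -/(end_poly n) subn0.
rewrite (_ : s./2 = n)%N; last by lia.
rewrite -exprS [mid_poly n ^+ _ * _]mulrC => <-; last by move=> j; case: ifP.
apply: eq_bigr => c /andP[/forallP cpos _].
rewrite big_ord_recl /= !end_coef_pos //.
rewrite [in RHS]big_mkcond [in RHS]big_ord_recl /= !mul1r.
under eq_bigr => j _ do rewrite mid_coef_pos //.
by rewrite big_split /= prodr_const card_ord; ring.
Qed.
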